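(* For any $a_1,a_2,a_3,b_1,b_2,b_3\in\mathbb{Z}_{\ge0}$, the following equality of rational functions in $t_1,t_2,t_3,\eta$ holds: $$\sum_{l_1,l_2,l_3}W^{\mathsf s}_{\eta t_2,\eta t_3}(a_3,a_2;l_3,l_2)\,W^{\mathsf s}_{t_1,t_3}(l_3,a_1;b_3,l_1)\,W^{\mathsf s}_{\eta t_1,\eta t_2}(l_2,l_1;b_2,b_1)$$ $$=\sum_{l_1,l_2,l_3}W^{\mathsf s}_{t_1,t_2}(a_2,a_1;l_2,l_1)\,W^{\mathsf s}_{\eta t_1,\eta t_3}(a_3,l_1;l_3,b_1)\,W^{\mathsf s}_{t_2,t_3}(l_3,l_2;b_3,b_2),$$ where the sums are over $l_1,l_2,l_3\in\mathbb{Z}_{\ge0}$.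
   Context: $q$ is a fixed generic parameter, $(x;q)_n:=\prod_{i=1}^n(1-xq^{i-1})$, $(x;q)_0:=1$. For $i,j,k,l\in\mathbb{Z}_{\ge0}$, $$W^{\mathsf s}_{t,s}(i,j;k,l):=\mathbf{1}_{i+j=k+l}\,\mathbf{1}_{i\ge l}\,s^{2l}t^{-2l}\frac{(s^2/t^2;q)_{i-l}(t^2;q)_l}{(s^2;q)_i}\frac{(q;q)_i}{(q;q)_{i-l}(q;q)_l}.$$ *)

(* Defs.v *)
From HB Require Import structures.
From mathcomp Require Import all_boot all_order all_algebra.
From mathcomp Require Import mpoly.
From mathcomp Require Import boolp classical_sets functions cardinality fsbigop.

Set Implicit Arguments.
Unset Strict Implicit.
Unset Printing Implicit Defensive.

Import GRing.Theory.

Local Open Scope ring_scope.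
Local Open Scope classical_set_scope.

Definition qpoch (F : fieldType) (q x : F) (n : nat) : F :=
  \prod_(i < n) (1 - x * q ^+ i).

(* The truncated subtraction i - l is only used under the guard l <= i. *)
Definition Ws (F : fieldType) (q t s : F) (i j k l : nat) : F :=
  if (i + j == k + l)%N && (l <= i)%N then
    s ^+ (2 * l)%N * t ^- (2 * l)%N
    * ((qpoch q (s ^+ 2 / t ^+ 2) (i - l) * qpoch q (t ^+ 2) l)
       / qpoch q (s ^+ 2) i)
    * (qpoch q q i / (qpoch q q (i - l) * qpoch q q l))
  else 0.

(* (q; q)_n must be invertible for all n, i.e. q is not a root of unity. *)
Definition generic (K : fieldType) (q : K) : Prop :=
  forall n : nat, (0 < n)%N -> q ^+ n != 1.

(* The field K(X_0, X_1, X_2, X_3); the equality on it is the equality of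
   rational functions. *)
Definition ratfun4 (K : fieldType) : fieldType := {fraction {mpoly K[4]}}.

Definition rf_const (K : fieldType) (c : K) : ratfun4 K :=
  tofrac (mpolyC 4 c).

Definition rf_var (K : fieldType) (i : 'I_4) : ratfun4 K :=
  tofrac ('X_i : {mpoly K[4]}).

(* A sum over an infinite set in the sense of fsbigop is 0 by convention when
   its support is infinite.  The lemmas below show that this convention is
   never used by the two sums over nat * nat * nat in the Yang-Baxter
   equation. *)

Lemma Ws_neq0 (F : fieldType) (q t s : F) (i j k l : nat) :
  Ws q t s i j k l != 0 -> (i + j = k + l)%N /\ (l <= i)%N.
Proof.
by rewrite /Ws; case: ifP => [/andP[/eqP -> ->] //|_]; rewrite eqxx.
Qed.

Lemma finite_box (N : nat) (A : set (nat * nat * nat)) :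
  (forall l1 l2 l3, A (l1, l2, l3) -> [/\ l1 <= N, l2 <= N & l3 <= N]%N) ->
  finite_set A.
Proof.
move=> AN; apply: (@sub_finite_set _ _ (`I_N.+1 `*` `I_N.+1 `*` `I_N.+1)).
  by move=> [[l1 l2] l3] /AN[? ? ?] /=; rewrite !ltnS.
by do 2?[apply: finite_setX => //]; exact: finite_II.
Qed.

Lemma YBE_lhs_finite (F : fieldType) (q t12 s12 t13 s13 t23 s23 : F)
    (a1 a2 a3 b1 b2 b3 : nat) :
  finite_set [set l : nat * nat * nat | (let: (l1, l2, l3) := l in
    Ws q t23 s23 a3 a2 l3 l2 * Ws q t13 s13 l3 a1 b3 l1
    * Ws q t12 s12 l2 l1 b2 b1) != 0].
Proof.
apply: (@finite_box (a1 + a2 + a3)) => l1 l2 l3 /=.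
rewrite !mulf_eq0 !negb_or => /andP[/andP[/Ws_neq0[e1 h1] /Ws_neq0[e2 h2]] _].
have l32 : (l3 + l2 <= a1 + a2 + a3)%N.
  by rewrite -e1 addnC -addnA leq_addl.
have h3 := leq_trans (leq_addr l2 l3) l32.
by split=> //; [exact: leq_trans h3|exact: leq_trans (leq_addl _ _) l32].
Qed.

Lemma YBE_rhs_finite (F : fieldType) (q t12 s12 t13 s13 t23 s23 : F)
    (a1 a2 a3 b1 b2 b3 : nat) :
  finite_set [set l : nat * nat * nat | (let: (l1, l2, l3) := l in
    Ws q t12 s12 a2 a1 l2 l1 * Ws q t13 s13 a3 l1 l3 b1
    * Ws q t23 s23 l3 l2 b3 b2) != 0].
Proof.
apply: (@finite_box (a1 + a2 + a3)) => l1 l2 l3 /=.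
rewrite !mulf_eq0 !negb_or => /andP[/andP[/Ws_neq0[e1 h1] /Ws_neq0[e2 h2]] _].
have l21 : (l2 + l1 <= a1 + a2)%N by rewrite -e1 addnC.
have h1' := leq_trans (leq_addl l2 l1) l21.
split.
- exact: leq_trans h1' (leq_addr _ _).
- exact: leq_trans (leq_trans (leq_addr _ _) l21) (leq_addr _ _).
- apply: leq_trans (leq_addr b1 l3) _.
  by rewrite -e2 addnC leq_add2r.
Qed.

(* Main.v *)
(* Up to the conservation law, W^s_{t,s}(i, j; k, l) is the q-Hahn weight
   [hahn q m x i l] with m = s^2/t^2 and x = t^2, and conservation leaves one
   free summation index on each side.  On the left, the weights of the vertices
   (2,3) and (1,2) compose into a weight independent of the intermediate index
   times a weight free of eta; the same eta-dependent factor appears on the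
   right.  What remains is [left_sum = right_sum], an identity between two 4phi3
   sums in u = t1^2, a = t2^2/t1^2, b = t3^2/t2^2 and three integers A, B, C.
   The recurrences of the q-Hahn weights in their first argument show that both
   sums satisfy one linear recurrence relating (A+1,B,C), (A,B+1,C), (A,B,C) and
   (A,B,C-1), which determines them from their values at A = 0. *)
Require Import Defs.
From HB Require Import structures.
From mathcomp Require Import all_boot all_order all_algebra.
From mathcomp Require Import ring zify.
From mathcomp Require Import mpoly.
From mathcomp Require Import boolp classical_sets functions cardinality fsbigop.

Set Implicit Arguments.
Unset Strict Implicit.
Unset Printing Implicit Defensive.

Import GRing.Theory.

Local Open Scope ring_scope.
Local Open Scope classical_set_scope.

(** * The q-Hahn weights in product form *)

Definition hahn (F : fieldType) (q m x : F) (n c : nat) : F :=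
  if (c <= n)%N then
    m ^+ c * ((qpoch q m (n - c) * qpoch q x c) / qpoch q (m * x) n)
    * (qpoch q q n / (qpoch q q (n - c) * qpoch q q c))
  else 0.

Definition shift (F : fieldType) (f : nat -> F) (c : nat) : F :=
  if c is c'.+1 then f c' else 0.

Lemma qpoch0 (F : fieldType) (q x : F) : qpoch q x 0 = 1.
Proof. by rewrite /qpoch big_ord0. Qed.

Lemma qpochS (F : fieldType) (q x : F) n :
  qpoch q x n.+1 = qpoch q x n * (1 - x * q ^+ n).
Proof. by rewrite /qpoch big_ord_recr. Qed.

Lemma qpoch_neq0 (F : fieldType) (q x : F) n :
  (forall k, 1 - x * q ^+ k != 0) -> qpoch q x n != 0.
Proof. by move=> h; apply/prodf_neq0 => i _. Qed.

Lemma hahn_gt (F : fieldType) (q m x : F) n c : (n < c)%N -> hahn q m x n c = 0.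
Proof. by move=> ltnc; rewrite /hahn leqNgt ltnc. Qed.

Lemma hahn00 (F : fieldType) (q m x : F) : hahn q m x 0 0 = 1.
Proof. by rewrite /hahn /= !qpoch0 expr0 !(mulr1, invr1). Qed.

Lemma hahnD (F : fieldType) (q m x : F) c d :
  hahn q m x (c + d) c =
    m ^+ c * ((qpoch q m d * qpoch q x c) / qpoch q (m * x) (c + d))
    * (qpoch q q (c + d) / (qpoch q q d * qpoch q q c)).
Proof. by rewrite /hahn leq_addr addKn. Qed.

(** Certificate device: each use subtracts [k] times a known equation from the goal, until a
    rational identity is left for [field]. *)
Lemma lincomb (R : fieldType) (k l r x y : R) :
  l = r -> x - k * l = y - k * r -> x = y.
Proof. by move=> -> /addIr. Qed.

Arguments lincomb {R} k {l r x y}.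

(** * Recurrences of the q-Hahn weights and of their averages *)

Section HahnRecurrences.
Context (F : fieldType) (q : F) (q0 : q != 0).
Context (q1 : forall n, 1 - q * q ^+ n != 0).

Let qq n : qpoch q q n != 0. Proof. exact: qpoch_neq0. Qed.

(** Ratio of neighbouring weights, cleared of denominators: the factor [1 - q ^+ c] covers [c = 0].
    In [hahn_extend], [q ^+ c - q ^+ n.+1] likewise covers [c = n.+1]. *)
Lemma hahn_absorb (m x : F) (mx : forall n, 1 - m * x * q ^+ n != 0) n c :
  (1 - m * x * q ^+ n) * (1 - q ^+ c) * hahn q m x n.+1 c
  = m * (1 - x * q ^+ c / q) * (1 - q ^+ n.+1) * shift (hahn q m x n) c.
Proof.
case: c => [|c] /=; first by rewrite expr0; ring.
have [lecn|ltnc] := leqP c n; last first.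
  by rewrite !hahn_gt ?mulr0 // ltnS.
rewrite -(subnKC lecn); set d := (n - c)%N.
rewrite -addSn !hahnD addSn !qpochS (exprS m) !(exprS q) exprD.
have := mx (c + d)%N; have := q1 (c + d)%N; rewrite exprD => h1 h2.
have h3 := q1 c; have h4 := qq d; have h5 := qq c.
have h6 : qpoch q (m * x) (c + d) != 0 by exact: qpoch_neq0.
by field; rewrite ?h1 ?h2 ?h3 ?h4 ?h5 ?h6 ?q0.
Qed.

Lemma hahn_extend (m x : F) (mx : forall n, 1 - m * x * q ^+ n != 0) n c :
  (1 - m * x * q ^+ n) * (q ^+ c - q ^+ n.+1) * hahn q m x n.+1 c
  = (q ^+ c - m * q ^+ n) * (1 - q ^+ n.+1) * hahn q m x n c.
Proof.
have [lecn|] := leqP c n; last first.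
  rewrite leq_eqVlt => /orP[/eqP <-|ltnc]; last by rewrite !hahn_gt ?mulr0 ?(ltnW ltnc).
  by rewrite subrr [in RHS]hahn_gt // !(mulr0, mul0r).
rewrite -(subnKC lecn); set d := (n - c)%N.
rewrite -addnS !hahnD addnS !qpochS !(exprS q) exprD.
have := mx (c + d)%N; have := q1 (c + d)%N; rewrite exprD => h1 h2.
have h3 := q1 d; have h4 := qq d; have h5 := qq c.
have h6 : qpoch q (m * x) (c + d) != 0 by exact: qpoch_neq0.
by field; rewrite ?h1 ?h2 ?h3 ?h4 ?h5 ?h6 ?q0.
Qed.

(** A q-Pascal rule: the prefactors of [hahn_absorb] and [hahn_extend] add up to [1 - q ^+ n.+1].
    Weighting the first by [q ^+ n.+1] gives [q ^+ c * (1 - q ^+ n.+1)] and the second rule,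
    [hahn_rec2]. *)
Lemma hahn_rec1 (m x : F) (mx : forall n, 1 - m * x * q ^+ n != 0) n c :
  (1 - m * x * q ^+ n) * hahn q m x n.+1 c
  = (q ^+ c - m * q ^+ n) * hahn q m x n c
    + m * (1 - x * q ^+ c / q) * shift (hahn q m x n) c.
Proof.
have := hahn_absorb mx n c; have := hahn_extend mx n c => e1 e2.
apply: (mulfI (q1 n)); rewrite -exprS.
transitivity ((1 - m * x * q ^+ n) * (1 - q ^+ c) * hahn q m x n.+1 c
  + (1 - m * x * q ^+ n) * (q ^+ c - q ^+ n.+1) * hahn q m x n.+1 c).
  by ring.
by rewrite e1 e2; ring.
Qed.

Lemma hahn_rec2 (m x : F) (mx : forall n, 1 - m * x * q ^+ n != 0) n c :
  (1 - m * x * q ^+ n) * hahn q m x n.+1 c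
  = (1 - m * q ^+ n / q ^+ c) * hahn q m x n c
    + q ^+ n.+1 / q ^+ c * m * (1 - x * q ^+ c / q) * shift (hahn q m x n) c.
Proof.
have qc : q ^+ c != 0 by rewrite expf_neq0.
have := hahn_absorb mx n c; have := hahn_extend mx n c => e1 e2.
apply: (mulfI (q1 n)); apply: (mulfI qc); rewrite -exprS.
transitivity (q ^+ n.+1 * ((1 - m * x * q ^+ n) * (1 - q ^+ c) * hahn q m x n.+1 c)
  + (1 - m * x * q ^+ n) * (q ^+ c - q ^+ n.+1) * hahn q m x n.+1 c).
  by ring.
rewrite e1 e2; move: (q ^+ n.+1) => z.
by field; rewrite ?q0 ?qc.
Qed.

(** An expectation: [mean_rec2] with [g] constantly 1 shows inductively that the weights sum to
    1. *)
Definition mean (m x : F) (n : nat) (g : nat -> F) : F :=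
  \sum_(l < n.+1) hahn q m x n l * g l.

Lemma mean_shift (m x : F) n (g f : nat -> F) :
  \sum_(l < n.+2) f l * shift (hahn q m x n) l * g l
  = mean m x n (fun l => f l.+1 * g l.+1).
Proof.
rewrite big_ord_recl /= mulr0 mul0r add0r; apply: eq_bigr => i _ /=.
by rewrite /bump /= add1n mulrCA mulrA.
Qed.

Lemma mean_widen (m x : F) n (g : nat -> F) :
  \sum_(l < n.+2) hahn q m x n l * g l = mean m x n g.
Proof. by rewrite big_ord_recr /= hahn_gt // mul0r addr0. Qed.

Lemma mean_rec1 (m x : F) (mx : forall n, 1 - m * x * q ^+ n != 0) n g :
  (1 - m * x * q ^+ n) * mean m x n.+1 g
  = mean m x n (fun l => (q ^+ l - m * q ^+ n) * g l
                         + m * (1 - x * q ^+ l) * g l.+1).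
Proof.
rewrite {1}/mean mulr_sumr.
under eq_bigr => l _ do rewrite mulrA hahn_rec1 // mulrDl.
rewrite big_split /= (mean_shift m x n g (fun l => m * (1 - x * q ^+ l / q))).
under eq_bigr => l _ do rewrite (mulrC _ (hahn _ _ _ _ _)) -[_ * g _]mulrA.
rewrite (mean_widen m x n (fun l => (q ^+ l - m * q ^+ n) * g l)) /mean -big_split.
apply: eq_bigr => l _ /=; rewrite exprS; field; exact: q0.
Qed.

Lemma mean_rec2 (m x : F) (mx : forall n, 1 - m * x * q ^+ n != 0) n g :
  (1 - m * x * q ^+ n) * mean m x n.+1 g
  = mean m x n (fun l => (1 - m * q ^+ n / q ^+ l) * g l
                   + q ^+ n / q ^+ l * m * (1 - x * q ^+ l) * g l.+1).
Proof.
rewrite {1}/mean mulr_sumr.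
under eq_bigr => l _ do rewrite mulrA hahn_rec2 // mulrDl.
rewrite big_split /=
  (mean_shift m x n g (fun l => q ^+ n.+1 / q ^+ l * m * (1 - x * q ^+ l / q))).
under eq_bigr => l _ do rewrite (mulrC _ (hahn _ _ _ _ _)) -[_ * g _]mulrA.
rewrite (mean_widen m x n (fun l => (1 - m * q ^+ n / q ^+ l) * g l)) /mean -big_split.
apply: eq_bigr => l _ /=; rewrite !exprS; field.
by rewrite q0 expf_neq0.
Qed.

End HahnRecurrences.

(** * The identity between the two single sums, for invertible q *)

Section TwoStep.
Context (F : fieldType) (q a b u : F) (q0 : q != 0).
Context (q1 : forall n, 1 - q * q ^+ n != 0).
Context (a0 : a != 0) (b0 : b != 0) (u0 : u != 0).
Context (au1 : forall n, 1 - a * u * q ^+ n != 0).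
Context (abu1 : forall n, 1 - a * b * u * q ^+ n != 0).
Context (ab1 : forall n, 1 - a * b * q ^+ n != 0).

(** Vertices (1,2) and (2,3) of the right side, with [A], [B], [C] standing for [a3 - b1], [a2],
    [b2]. *)
Definition right_sum A B C : F :=
  mean q a u B (fun l => hahn q b (a * u) (A + l) C).

(** The guard removes [k > C], where the truncated [C - k] would select the weight at 0. *)
Definition left_sum A B C : F :=
  mean q b a A (fun k => if (k <= C)%N then
    hahn q (a * b) u (A + B - k) (C - k) else 0).

Let qn n : q ^+ n != 0. Proof. exact: expf_neq0. Qed.

Let bau1 n : 1 - b * (a * u) * q ^+ n != 0.
Proof. by have := abu1 n; rewrite mulrA (mulrC b). Qed.

Let ba1 n : 1 - b * a * q ^+ n != 0.
Proof. by have := ab1 n; rewrite (mulrC b). Qed.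

(** After multiplying [mean_rec1] by [b * q ^+ A], its coefficients depending on [l] are those of
    [hahn_rec1] at [A + l]; the rest is constant in [l]. *)
Lemma right_sum_recT A B C :
  b * q ^+ A * (1 - a * u * q ^+ B) * right_sum A B.+1 C
  = (a * b * q ^+ A - 1) * right_sum A.+1 B C
    + (q ^+ C - a * b * (q ^+ A * q ^+ B)) * right_sum A B C
    + b * (1 - a * u * q ^+ C / q) * shift (right_sum A B) C.
Proof.
have -> : shift (right_sum A B) C =
    mean q a u B (fun l => shift (hahn q b (a * u) (A + l)) C).
  case: C => [|C] //=; rewrite /mean big1 // => i _; exact: mulr0.
rewrite /right_sum -mulrA mean_rec1 // /mean !mulr_sumr -!big_split /=.
apply: eq_bigr => l _ /=.
have := hahn_rec1 q0 q1 bau1 (A + l) C; rewrite addnS addSn !exprD => e.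
apply: (lincomb (hahn q a u B l) e); field; exact: q0.
Qed.

Lemma right_sum0 A C : right_sum A 0 C = hahn q b (a * u) A C.
Proof. by rewrite /right_sum /mean big_ord1 hahn00 mul1r addn0. Qed.

Lemma left_sum0 B C : left_sum 0 B C = hahn q (a * b) u B C.
Proof. by rewrite /left_sum /mean big_ord1 hahn00 mul1r add0n !subn0. Qed.

(* Let T_B denote the operator on functions of (A, C) which, by right_sum_recT,
   computes right_sum _ B.+1 _ from right_sum _ B _, and D_B the operator whose
   vanishing is stated here.  The induction works because D_{B+1} T_B = X D_B
   for an operator X of the same shape as T_B. *)
Lemma right_sum_recD A B C :
  (1 - a * b * u * (q ^+ A * q ^+ B)) * (a * b * q ^+ A - 1) * right_sum A.+1 B C
  + (q ^+ C - a * b * (q ^+ A * q ^+ B)) * (1 - b * q ^+ A / q ^+ C) * right_sum A B C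
  + b * (1 - a * u * q ^+ C / q) * (1 - a * b * (q ^+ A * q ^+ A * q ^+ B.+1) / q ^+ C)
    * shift (right_sum A B) C = 0.
Proof.
elim: B A C => [|B IH] A C.
  have -> : shift (right_sum A 0) C = shift (hahn q b (a * u) A) C.
    by case: C => [|C] //=; rewrite right_sum0.
  rewrite !right_sum0.
  have e1 := hahn_rec1 q0 q1 bau1 A C.
  have e2 := hahn_rec2 q0 q1 bau1 A C.
  apply: (lincomb (-1) e1); apply: (lincomb (a * b * q ^+ A) e2).
  rewrite !exprS expr0; field.
  by rewrite q0 qn.
(* This is the factor of [right_sum A.+1 B.+1 C] in [right_sum_recT]. The factor at [A] lacks one
   [q], hence the multipliers [q] below. *)
have k0 : b * q ^+ A.+1 * (1 - a * u * q ^+ B) != 0.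
  by rewrite !mulf_neq0 ?au1.
apply: (mulfI k0).
apply: (lincomb ((1 - a * b * u * (q ^+ A * q ^+ B.+1)) * (a * b * q ^+ A - 1))
  (right_sum_recT A.+1 B C)).
apply: (lincomb (q * (q ^+ C - a * b * (q ^+ A * q ^+ B.+1)) * (1 - b * q ^+ A / q ^+ C))
  (right_sum_recT A B C)).
(* The multipliers of the [IH] instances are the coefficients of X. *)
apply: (lincomb (a * b * q ^+ A - 1) (IH A.+1 C)).
apply: (lincomb (q * (q ^+ C - a * b * (q ^+ A * q ^+ B.+1))) (IH A C)).
case: C => [|C] /=.
  by rewrite !exprS expr0; field; rewrite ?oner_neq0 ?q0.
apply: (lincomb (q * (b * (1 - a * u * q ^+ C)
    * (1 - a * b * (q ^+ A * q ^+ A * q ^+ B.+1) / q ^+ C))) (right_sum_recT A B C)).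
apply: (lincomb (q * (b * (1 - a * u * q ^+ C))) (IH A C)).
rewrite !exprS; field.
by rewrite q0 qn.
Qed.

(** Subtracting [right_sum_recD] from [right_sum_recT] gives the form that the left sum satisfies
    term by term. *)
Lemma right_sum_recL A B C :
  (1 - a * u * q ^+ B) * right_sum A B.+1 C
  = (1 - a * b * (q ^+ A * q ^+ B) / q ^+ C) * right_sum A B C
    + a * b * (q ^+ A * q ^+ B.+1) / q ^+ C * (1 - a * u * q ^+ C / q)
      * shift (right_sum A B) C
    - a * u * q ^+ B * (1 - a * b * q ^+ A) * right_sum A.+1 B C.
Proof.
have k0 : b * q ^+ A != 0 by rewrite mulf_neq0.
apply: (mulfI k0).
apply: (lincomb 1 (right_sum_recT A B C)).
apply: (lincomb 1 (right_sum_recD A B C)).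
rewrite !exprS; field.
by rewrite q0 qn.
Qed.

(* Eliminating the argument A.+1 between recT and recL gives a recurrence in B
   alone, which at A = 0 is a combination of hahn_rec1 and hahn_rec2. *)
Lemma right_sum_A0 B C : right_sum 0 B C = hahn q (a * b) u B C.
Proof.
elim: B C => [|B IH] C.
  by rewrite right_sum0; case: C => [|C]; rewrite ?hahn00 ?hahn_gt.
have eS : shift (right_sum 0 B) C = shift (hahn q (a * b) u B) C.
  by case: C => [|C] /=.
apply: (mulfI (abu1 B)); apply: (mulfI (au1 B)).
apply: (lincomb 1 (right_sum_recL 0 B C)).
apply: (lincomb (- (a * u * q ^+ B)) (right_sum_recT 0 B C)).
apply: (lincomb (-1) (hahn_rec2 q0 q1 abu1 B C)).
apply: (lincomb (a * u * q ^+ B) (hahn_rec1 q0 q1 abu1 B C)).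
rewrite eS IH !exprS expr0; field.
by rewrite q0 qn.
Qed.

(** [mean_rec2] moves [A.+1] to [A]; its [k.+1] term has weight index [A + B - k], so [hahn_rec2]
    there closes the relation for each [k]. *)
Lemma left_sum_recL A B C :
  (1 - a * u * q ^+ B) * left_sum A B.+1 C
  = (1 - a * b * (q ^+ A * q ^+ B) / q ^+ C) * left_sum A B C
    + a * b * (q ^+ A * q ^+ B.+1) / q ^+ C * (1 - a * u * q ^+ C / q)
      * shift (left_sum A B) C
    - a * u * q ^+ B * ((1 - b * a * q ^+ A) * left_sum A.+1 B C).
Proof.
have -> : shift (left_sum A B) C = mean q b a A
    (fun k => if (k < C)%N then hahn q (a * b) u (A + B - k) (C - k.+1) else 0).
  case: C => [|C] /=; last by apply: eq_bigr.
  by rewrite /mean big1 // => i _; exact: mulr0.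
rewrite mean_rec2 // /left_sum /mean !mulr_sumr -big_split -sumrB /=.
apply: eq_bigr => k _.
have kA : (k <= A)%N by rewrite -ltnS.
rewrite addnS addSn !subSS (subSn (leq_trans kA (leq_addr B A))).
have [kC|kC] := leqP k C; last first.
  by rewrite (leq_gtF (ltnW kC)) !(mulr0, subr0, addr0).
have -> : (if (k < C)%N then hahn q (a * b) u (A + B - k) (C - k.+1) else 0)
    = shift (hahn q (a * b) u (A + B - k)) (C - k).
  have [kC'|Ck] := ltnP k C; first by rewrite -(subnSK kC').
  by move: Ck; rewrite -subn_eq0 => /eqP ->.
have eA : q ^+ A = q ^+ k * q ^+ (A - k) by rewrite -exprD subnKC.
have eC : q ^+ C = q ^+ k * q ^+ (C - k) by rewrite -exprD subnKC.
apply: (lincomb (hahn q b a A k) (hahn_rec2 q0 q1 abu1 (A + B - k) (C - k))).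
rewrite -addnBAC // !exprS exprD eA eC; field.
by rewrite q0 !qn.
Qed.

Lemma left_sumE A B C : left_sum A B C = right_sum A B C.
Proof.
elim: A B C => [|A IH] B C; first by rewrite left_sum0 right_sum_A0.
(* The coefficient of the [A.+1] term: the common recurrence is solved for that term. *)
have k0 : a * u * q ^+ B * (1 - a * b * q ^+ A) != 0 by rewrite !mulf_neq0.
apply: (mulfI k0).
apply: (lincomb 1 (left_sum_recL A B C)).
apply: (lincomb (-1) (right_sum_recL A B C)).
have -> : shift (left_sum A B) C = shift (right_sum A B) C by case: C => [|C] /=.
by rewrite !IH; ring.
Qed.

End TwoStep.

(** * Specialization of an indeterminate to q *)

Section Specialization.
Context (F : fieldType) (q : F).

(** [x] is regular at X = q with value [y]; a relation, since evaluation of fractions is partial. *)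
Definition specializes (x : {fraction {poly F}}) (y : F) :=
  exists P Q : {poly F},
    [/\ Q.[q] != 0, x * tofrac Q = tofrac P & P.[q] = y * Q.[q]].

Lemma specializes_poly (P : {poly F}) : specializes (tofrac P) P.[q].
Proof. by exists P, 1; rewrite hornerC oner_neq0 tofrac1 !mulr1. Qed.

Lemma specializesC (c : F) : specializes (tofrac c%:P) c.
Proof. by rewrite -[X in specializes _ X](hornerC c q); exact: specializes_poly. Qed.

Lemma specializes0 : specializes 0 0.
Proof. by rewrite -[X in specializes X _]tofrac0; exact: specializesC. Qed.

Lemma specializes1 : specializes 1 1.
Proof. by rewrite -[X in specializes X _]tofrac1; exact: specializesC. Qed.

Lemma specializes_inj x y y' : specializes x y -> specializes x y' -> y = y'.
Proof.
move=> [P [Q [Q0 xP Pq]]] [P' [Q' [Q'0 xP' P'q]]].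
have : P * Q' = P' * Q.
  by apply/eqP; rewrite -tofrac_eq !tofracM -xP -xP' mulrAC.
move=> /(congr1 (horner^~ q)); rewrite !hornerM Pq P'q mulrAC => e.
by apply: (mulIf Q'0); apply: (mulIf Q0).
Qed.

Lemma specializesD x x' y y' :
  specializes x y -> specializes x' y' -> specializes (x + x') (y + y').
Proof.
move=> [P [Q [Q0 xP Pq]]] [P' [Q' [Q'0 xP' P'q]]].
exists (P * Q' + P' * Q), (Q * Q').
rewrite hornerM mulf_neq0 // tofracD !tofracM -xP -xP' hornerD !hornerM Pq P'q.
by split=> //; ring.
Qed.

Lemma specializesN x y : specializes x y -> specializes (- x) (- y).
Proof.
by move=> [P [Q [Q0 xP Pq]]]; exists (- P), Q; rewrite tofracN -xP hornerN Pq !mulNr.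
Qed.

Lemma specializesM x x' y y' :
  specializes x y -> specializes x' y' -> specializes (x * x') (y * y').
Proof.
move=> [P [Q [Q0 xP Pq]]] [P' [Q' [Q'0 xP' P'q]]]; exists (P * P'), (Q * Q').
rewrite hornerM mulf_neq0 // !tofracM -xP -xP' !hornerM Pq P'q.
by split=> //; ring.
Qed.

(** Carries the non-vanishing hypotheses from q up to the indeterminate. *)
Lemma specializes_neq0 x y : specializes x y -> y != 0 -> x != 0.
Proof.
move=> xy; apply: contra_neq => x0; move: xy; rewrite x0 => xy.
exact: specializes_inj xy specializes0.
Qed.

Lemma specializesV x y : specializes x y -> y != 0 -> specializes x^-1 y^-1.
Proof.
move=> xy y0; have x0 := specializes_neq0 xy y0.
move: xy => [P [Q [Q0 xP Pq]]]; exists Q, P.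
rewrite -xP Pq mulf_neq0 // mulrA mulVf // mul1r mulKf //.
Qed.

Lemma specializesX x y n : specializes x y -> specializes (x ^+ n) (y ^+ n).
Proof.
move=> xy; elim: n => [|n IH]; last by rewrite !exprS; exact: specializesM.
by rewrite !expr0; exact: specializes1.
Qed.

Lemma specializes_sum n x y : (forall i : 'I_n, specializes (x i) (y i)) ->
  specializes (\sum_(i < n) x i) (\sum_(i < n) y i).
Proof.
move=> xy; apply: (big_ind2 specializes) => // [|x1 y1 x2 y2].
  exact: specializes0.
exact: specializesD.
Qed.

Let Q : {fraction {poly F}} := tofrac 'X.

Let specq : specializes Q q.
Proof. by rewrite -[X in specializes _ X]hornerX; exact: specializes_poly. Qed.

Lemma specializes_factor x y n :
  specializes x y -> specializes (1 - x * Q ^+ n) (1 - y * q ^+ n).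
Proof.
move=> xy; apply: specializesD; first exact: specializes1.
by apply: specializesN; apply: specializesM => //; exact: specializesX.
Qed.

Lemma specializes_qpoch x y n :
  specializes x y -> specializes (qpoch Q x n) (qpoch q y n).
Proof.
move=> xy; apply: (big_ind2 specializes) => // [|x1 y1 x2 y2|i _].
- exact: specializes1.
- exact: specializesM.
- exact: specializes_factor.
Qed.

Lemma specializes_hahn m x m' x' n c :
  (forall n, 1 - q * q ^+ n != 0) -> (forall n, 1 - m' * x' * q ^+ n != 0) ->
  specializes m m' -> specializes x x' ->
  specializes (hahn Q m x n c) (hahn q m' x' n c).
Proof.
move=> q1 mx1 mm' xx'; rewrite /hahn.
case: ifP => _; last exact: specializes0.
have sp y y' k := @specializes_qpoch y y' k.
apply: specializesM; [apply: specializesM|].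
- exact: specializesX.
- apply: specializesM; first by apply: specializesM; exact: sp.
  apply: specializesV; last exact: qpoch_neq0.
  by apply: sp; exact: specializesM.
- apply: specializesM; first exact: sp.
  apply: specializesV; first by apply: specializesM; exact: sp.
  by rewrite mulf_neq0 // qpoch_neq0.
Qed.

(* The recurrences divide by powers of q, which may be 0 here; with q replaced
   by an indeterminate the identity holds, and it specializes. *)
Lemma two_step_sums (a b u : F) (q1 : forall n, 1 - q * q ^+ n != 0)
    (a0 : a != 0) (b0 : b != 0) (u0 : u != 0)
    (au1 : forall n, 1 - a * u * q ^+ n != 0)
    (abu1 : forall n, 1 - a * b * u * q ^+ n != 0)
    (ab1 : forall n, 1 - a * b * q ^+ n != 0) A B C :
  left_sum q a b u A B C = right_sum q a b u A B C.
Proof.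
pose cst (c : F) : {fraction {poly F}} := tofrac c%:P.
have sc c : specializes (cst c) c by exact: specializesC.
have scM c d : specializes (cst c * cst d) (c * d) by exact: specializesM.
have scM3 c d e : specializes (cst c * cst d * cst e) (c * d * e).
  exact: specializesM.
have Q0 : Q != 0 by rewrite tofrac_eq0 polyX_eq0.
have eq_LR : left_sum Q (cst a) (cst b) (cst u) A B C =
    right_sum Q (cst a) (cst b) (cst u) A B C.
  apply: left_sumE.
  - exact: Q0.
  - by move=> n; exact: specializes_neq0 (specializes_factor n specq) (q1 n).
  - exact: specializes_neq0 (sc a) a0.
  - exact: specializes_neq0 (sc b) b0.
  - exact: specializes_neq0 (sc u) u0.
  - by move=> n; exact: specializes_neq0 (specializes_factor n (scM a u)) (au1 n).
  - by move=> n; exact: specializes_neq0 (specializes_factor n (scM3 a b u)) (abu1 n).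
  - by move=> n; exact: specializes_neq0 (specializes_factor n (scM a b)) (ab1 n).
have ba1 n : 1 - b * a * q ^+ n != 0 by rewrite (mulrC b).
have bau1 n : 1 - b * (a * u) * q ^+ n != 0 by rewrite mulrA (mulrC b).
apply: (@specializes_inj (left_sum Q (cst a) (cst b) (cst u) A B C)).
  apply: specializes_sum => k; apply: specializesM.
    exact: specializes_hahn q1 ba1 (sc b) (sc a).
  case: ifP => _; last exact: specializes0.
  exact: specializes_hahn q1 abu1 (scM a b) (sc u).
rewrite eq_LR; apply: specializes_sum => k; apply: specializesM.
  exact: specializes_hahn q1 au1 (sc a) (sc u).
exact: specializes_hahn q1 bau1 (sc b) (scM a u).
Qed.

End Specialization.

(** * Reduction of the Yang-Baxter equation to the single sums *)

Lemma Ws_hahn (F : fieldType) (q t s : F) i j k l :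
  t != 0 -> (i + j = k + l)%N ->
  Ws q t s i j k l = hahn q (s ^+ 2 / t ^+ 2) (t ^+ 2) i l.
Proof.
move=> t0 ijkl; rewrite /Ws /hahn ijkl eqxx /=; case: ifP => // _.
by rewrite divfK ?expf_neq0 // expr_div_n -!exprM.
Qed.

(** The symbols [qpoch q (m * x) (c + k)] cancel on the left, [qpoch q (m * m') (n - c)] on the
    right, and both pairs of q-binomials form the same q-trinomial. *)
Lemma hahn_comp (F : fieldType) (q m m' x : F) n c k :
  (forall n, 1 - q * q ^+ n != 0) -> (forall n, 1 - m * x * q ^+ n != 0) ->
  (forall n, 1 - m * m' * q ^+ n != 0) -> (c <= n)%N ->
  hahn q m' (m * x) n (c + k) * hahn q m x (c + k) c
  = hahn q (m * m') x n c * hahn q m' m (n - c) k.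
Proof.
move=> q1 mx1 mm1 cn; rewrite -(subnKC cn) addKn; set N := (n - c)%N.
have [kN|Nk] := leqP k N; last first.
  by rewrite hahn_gt ?ltn_add2l // mul0r [X in _ * X]hahn_gt ?mulr0.
rewrite -(subnKC kN); set d := (N - k)%N.
rewrite addnA !hahnD -addnA hahnD (mulrC m' m) (mulrCA m') (mulrA m) exprD exprMn.
have qq j : qpoch q q j != 0 by exact: qpoch_neq0.
have h1 : qpoch q (m * x) (c + k) != 0 by exact: qpoch_neq0.
have h2 : qpoch q (m * m') (k + d) != 0 by exact: qpoch_neq0.
(* This inverse is common to both sides; kept opaque, it creates no side condition for [field]. *)
move: (qpoch q (m * m' * x) _)^-1 => y.
by field; rewrite h1 h2 !qq.
Qed.

Lemma fsbig_reindex_ord (F : fieldType) (T : choiceType) (f : T -> F)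
    (g : nat -> T) n :
  injective g -> (forall l, f l != 0 -> exists2 k, (k < n)%N & l = g k) ->
  \sum_(l \in [set: T]) f l = \sum_(k < n) f (g k).
Proof.
move=> g_inj fg; rewrite -(fsbig_widen [set` [seq g k | k <- iota 0 n]] setT) //.
  rewrite -fsbig_seq ?map_inj_uniq ?iota_uniq // big_map.
  by rewrite -{1}(subn0 n) -/(index_iota 0 n) big_mkord.
move=> l [_ /= lg]; apply: contra_notP lg => /eqP/fg[k kn ->].
by apply: map_f; rewrite mem_iota.
Qed.

Lemma yang_baxter (F : fieldType) (q t1 t2 t3 eta : F)
    (q1 : forall n, 1 - q * q ^+ n != 0)
    (t1_0 : t1 != 0) (t2_0 : t2 != 0) (t3_0 : t3 != 0) (eta0 : eta != 0)
    (t2q : forall n, 1 - t2 ^+ 2 * q ^+ n != 0)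
    (t3q : forall n, 1 - t3 ^+ 2 * q ^+ n != 0)
    (t31q : forall n, 1 - t3 ^+ 2 / t1 ^+ 2 * q ^+ n != 0)
    (et2q : forall n, 1 - (eta * t2) ^+ 2 * q ^+ n != 0)
    (a1 a2 a3 b1 b2 b3 : nat) :
  \sum_(l \in [set: nat * nat * nat]) (let: (l1, l2, l3) := l in
    Ws q (eta * t2) (eta * t3) a3 a2 l3 l2
    * Ws q t1 t3 l3 a1 b3 l1
    * Ws q (eta * t1) (eta * t2) l2 l1 b2 b1)
  =
  \sum_(l \in [set: nat * nat * nat]) (let: (l1, l2, l3) := l in
    Ws q t1 t2 a2 a1 l2 l1
    * Ws q (eta * t1) (eta * t3) a3 l1 l3 b1
    * Ws q t2 t3 l3 l2 b3 b2).
Proof.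
pose f (l : nat * nat * nat) := let: (l1, l2, l3) := l in
  Ws q (eta * t2) (eta * t3) a3 a2 l3 l2 * Ws q t1 t3 l3 a1 b3 l1
  * Ws q (eta * t1) (eta * t2) l2 l1 b2 b1.
pose f' (l : nat * nat * nat) := let: (l1, l2, l3) := l in
  Ws q t1 t2 a2 a1 l2 l1 * Ws q (eta * t1) (eta * t3) a3 l1 l3 b1
  * Ws q t2 t3 l3 l2 b3 b2.
change (\sum_(l \in [set: nat * nat * nat]) f l
  = \sum_(l \in [set: nat * nat * nat]) f' l).
have f_neq0 l1 l2 l3 : f (l1, l2, l3) != 0 ->
    [/\ (a3 + a2 = l3 + l2)%N /\ (l2 <= a3)%N,
        (l3 + a1 = b3 + l1)%N /\ (l1 <= l3)%N &
        (l2 + l1 = b2 + b1)%N /\ (b1 <= l2)%N].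
  by rewrite /f !mulf_eq0 !negb_or => /andP[/andP[/Ws_neq0 ? /Ws_neq0 ?] /Ws_neq0].
have f'_neq0 l1 l2 l3 : f' (l1, l2, l3) != 0 ->
    [/\ (a2 + a1 = l2 + l1)%N /\ (l1 <= a2)%N,
        (a3 + l1 = l3 + b1)%N /\ (b1 <= a3)%N &
        (l3 + l2 = b3 + b2)%N /\ (b2 <= l3)%N].
  by rewrite /f' !mulf_eq0 !negb_or => /andP[/andP[/Ws_neq0 ? /Ws_neq0 ?] /Ws_neq0].
(* A nonzero term on either side forces [cons]; otherwise both sums vanish. *)
pose cons := ((a1 + a2 + a3 == b1 + b2 + b3)%N && (b1 <= a3)%N).
have f_cons l1 l2 l3 : f (l1, l2, l3) != 0 -> cons.
  by case/f_neq0=> [[? ?] [? ?] [? ?]]; rewrite /cons; lia.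
have f'_cons l1 l2 l3 : f' (l1, l2, l3) != 0 -> cons.
  by case/f'_neq0=> [[? ?] [? ?] [? ?]]; rewrite /cons; lia.
have [/andP[/eqP a_b b1a3]|ncons] := boolP cons; last first.
  by rewrite !fsbig1 // => -[[l1 l2] l3] _; apply: contraNeq ncons;
    [exact: f'_cons|exact: f_cons].
have [A a3E] : exists A, a3 = (b1 + A)%N by exists (a3 - b1)%N; rewrite subnKC.
(* Conservation solved with [l2 = b1 + k] on the left and [l1 = l] on the right; [l2 <= a3] and
   [l1 <= a2] give the ranges. *)
pose g k := (b2 - k, b1 + k, a2 + A - k)%N.
pose g' l := (l, a1 + a2 - l, A + l)%N.
rewrite (@fsbig_reindex_ord _ _ f g A.+1); first last.
- move=> [[l1 l2] l3] /f_neq0[[? ?] [? ?] [? ?]].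
  by exists (l2 - b1)%N; [|congr (_, _, _)]; lia.
- by move=> k k' [_ /addnI].
rewrite (@fsbig_reindex_ord _ _ f' g' a2.+1); first last.
- move=> [[l1 l2] l3] /f'_neq0[[? ?] [? ?] [? ?]].
  by exists l1; [|congr (_, _, _)]; lia.
- by move=> k k' [].
pose u := t1 ^+ 2; pose a := t2 ^+ 2 / t1 ^+ 2; pose b := t3 ^+ 2 / t2 ^+ 2.
pose y := (eta * t1) ^+ 2.
have au : a * u = t2 ^+ 2 by rewrite /a divfK ?expf_neq0.
have ab : a * b = t3 ^+ 2 / t1 ^+ 2.
  by rewrite /a /b mulrC mulrA divfK ?expf_neq0.
have abu : a * b * u = t3 ^+ 2 by rewrite ab divfK ?expf_neq0.
have ay : a * y = (eta * t2) ^+ 2 by rewrite /a /y; field.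
have ay1 n : 1 - a * y * q ^+ n != 0 by rewrite ay.
have ab1 n : 1 - a * b * q ^+ n != 0 by rewrite ab.
(* [eta] cancels in the first parameter of [hahn] and survives only in the second. *)
have ratio s t : (eta * s) ^+ 2 / (eta * t) ^+ 2 = s ^+ 2 / t ^+ 2.
  by rewrite !exprMn -mulf_div divff ?mul1r ?expf_neq0.
(* The prefactor is the weight of vertex (1,3) on the right; on the left [hahn_comp] extracts it. *)
transitivity (hahn q (a * b) y a3 b1 * left_sum q a b u A a2 b2).
  rewrite /left_sum /mean mulr_sumr; apply: eq_bigr => k _.
  have kA : (k <= A)%N by rewrite -ltnS.
  (* For [k > b2] the truncated [b2 - k] violates conservation at vertex (1,2), so the term is 0, as
     in [left_sum]. *)
  have [kb2|b2k] := leqP k b2; last first.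
    rewrite !mulr0; apply/eqP/contraT => /f_neq0[[? ?] [? ?] [? ?]].
    by exfalso; lia.
  rewrite /f /g !Ws_hahn ?mulf_neq0 //; try lia.
  rewrite !ratio -/a -/b -/y -ay -ab -/u mulrAC.
  rewrite (hahn_comp _ q1 ay1 ab1) ?a3E ?leq_addr // addKn.
  by rewrite mulrA (addnC a2).
rewrite two_step_sums //; last first.
- by rewrite abu.
- by rewrite au.
- by rewrite expf_neq0.
- by rewrite mulf_neq0 ?invr_eq0 ?expf_neq0.
- by rewrite mulf_neq0 ?invr_eq0 ?expf_neq0.
rewrite /right_sum /mean mulr_sumr; apply: eq_bigr => l _.
have la2 : (l <= a2)%N by rewrite -ltnS.
rewrite /f' /g' !Ws_hahn ?mulf_neq0 //; try lia.
by rewrite !ratio -/a -/b -/y -/u -ab -au mulrCA -mulrA.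
Qed.

(** * Non-vanishing in the field of rational functions, by evaluation at points *)

Lemma sub_div_neq0 (F : fieldType) (s t c : F) :
  t != 0 -> t ^+ 2 - s ^+ 2 * c != 0 -> 1 - s ^+ 2 / t ^+ 2 * c != 0.
Proof.
move=> t0; apply: contra_neq => e.
by rewrite -[LHS](mulfK (expf_neq0 2 t0)) -[X in _ = X](mul0r (t ^+ 2)) -e; field.
Qed.

Lemma rf_neq (K : fieldType) (P Q : {mpoly K[4]}) (v : 'I_4 -> K) :
  P.@[v] != Q.@[v] -> tofrac P - tofrac Q != 0 :> ratfun4 K.
Proof. by rewrite subr_eq0 tofrac_eq; apply: contra_neq => ->. Qed.

Theorem proposition3p1 (K : fieldType) (q0 : K) (hq : generic q0)
    (a1 a2 a3 b1 b2 b3 : nat) :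
  let q := rf_const q0 in
  let t1 := rf_var K (inord 0) in
  let t2 := rf_var K (inord 1) in
  let t3 := rf_var K (inord 2) in
  let eta := rf_var K (inord 3) in
  \sum_(l \in [set: nat * nat * nat]) (let: (l1, l2, l3) := l in
    Ws q (eta * t2) (eta * t3) a3 a2 l3 l2
    * Ws q t1 t3 l3 a1 b3 l1
    * Ws q (eta * t1) (eta * t2) l2 l1 b2 b1)
  =
  \sum_(l \in [set: nat * nat * nat]) (let: (l1, l2, l3) := l in
    Ws q t1 t2 a2 a1 l2 l1
    * Ws q (eta * t1) (eta * t3) a3 l1 l3 b1
    * Ws q t2 t3 l3 l2 b3 b2).
Proof.
move=> q t1 t2 t3 eta.
have qE n : q ^+ n = tofrac (q0 ^+ n)%:MP by rewrite rmorphXn tofracXn.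
have var_neq0 i : rf_var K i != 0.
  rewrite -[rf_var K i]subr0 -tofrac0.
  by apply: (@rf_neq _ _ _ (fun=> 1)); rewrite mevalXU meval0 oner_neq0.
have sqr_neq1 (P : {mpoly K[4]}) n : P.@[fun=> 0] = 0 ->
    1 - tofrac P ^+ 2 * q ^+ n != 0 :> ratfun4 K.
  move=> P0; rewrite qE -tofracXn -tofracM -tofrac1.
  apply: (@rf_neq _ _ _ (fun=> 0)).
  by rewrite expr2 !mevalM P0 !mul0r meval1 oner_neq0.
apply: yang_baxter => [n|||||n|n|n|n].
- rewrite -exprS qE -tofrac1.
  apply: (@rf_neq _ _ _ (fun=> 0)).
  by rewrite meval1 mevalC eq_sym hq.
- exact: (var_neq0 (inord 0)).
- exact: (var_neq0 (inord 1)).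
- exact: (var_neq0 (inord 2)).
- exact: (var_neq0 (inord 3)).
- by apply: (sqr_neq1 'X_(inord 1)); rewrite mevalXU.
- by apply: (sqr_neq1 'X_(inord 2)); rewrite mevalXU.
- apply: sub_div_neq0; first exact: (var_neq0 (inord 0)).
  rewrite qE -!tofracXn -tofracM.
  (* At [t1 = 1] with the other variables 0, the two polynomials take the values 1 and 0. *)
  apply: (@rf_neq _ _ _ (fun i => (i == inord 0)%:R)).
  rewrite !expr2 !mevalM !mevalXU eqxx !mul1r.
  by rewrite -val_eqE /= !inordK // !mul0r oner_neq0.
- rewrite -tofracM; apply: (sqr_neq1 ('X_(inord 3) * 'X_(inord 1))).
  by rewrite mevalM !mevalXU mul0r.
Qed.
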